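(* Let $n\geq 10$ be an integer with $n\equiv 1\pmod 3$. Let $\hat{L}$ be the $n\times n$ matrix $$\hat{L}=\frac{n-1}{3}I_n-\frac13\begin{bmatrix}0&\mathbf{e}'\\ \mathbf{e}&\mathbf{0}\end{bmatrix}+\begin{bmatrix}0&\mathbf{0}'\\ \mathbf{0}&P\end{bmatrix},$$ where $P$ is the $(n-1)\times(n-1)$ circulant matrix defined in the context. Then $\hat{L}$ is a Laplacian-like matrix.
   Context: A real square matrix $A$ is called Laplacian-like if $A\mathbf{e}=0$ and $\mathbf{e}'A=0$, where $\mathbf{e}$ is the all-ones column vector of the appropriate size. The prime denotes transpose and $I_n$ is the identity matrix. In the block matrices the blocks have sizes $1$ and $n-1$, and $\mathbf{e}$ there lies in $\mathbb{R}^{n-1}$. For a vector $\mathbf{c}=(c_1,\dots,c_m)'$, $\operatorname{Circ}(\mathbf{c}')$ is the $m\times m$ circulant matrix with first row $(c_1,\dots,c_m)$ and each subsequent row the cyclic right shift by one of the previous row. Definition of $P$ (for $n\equiv 1\pmod 3$, $n\ge 10$). Let $\mathbf{e_i}$ be the $i$-th standard basis vector of $\mathbb{R}^{n-1}$ and $\mathbf{c_k}=\mathbf{e_{k+1}}+\mathbf{e_{n-k}}\in\mathbb{R}^{n-1}$, for $1\le k\le \frac{n-2}{2}$ if $n$ is even and $1\le k\le\frac{n-3}{2}$ if $n$ is odd. If $n$ is even, $P=\frac{1}{3(n-1)}\operatorname{Circ}(\mathbf{z_1}')$ with $$\mathbf{z_1}=(2n-n^2)\mathbf{e_1}+\sum_{k=1}^{\frac{n-4}{6}}\left(\frac{3n-18k+8}{2}\mathbf{c_{3k-2}}-\frac{3n-18k+4}{2}\mathbf{c_{3k-1}}+\mathbf{c_{3k}}\right)+\mathbf{c_{\frac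 n2-1}}.$$ If $n$ is odd, $P=\frac{1}{3(n-1)}\operatorname{Circ}(\mathbf{z_2}')$ with $$\mathbf{z_2}=(2n-n^2)\mathbf{e_1}+\sum_{k=1}^{\frac{n-1}{6}}\left(\frac{3n-18k+8}{2}\mathbf{c_{3k-2}}-\frac{3n-18k+4}{2}\mathbf{c_{3k-1}}\right)+\sum_{k=1}^{\frac{n-7}{6}}\mathbf{c_{3k}}+\mathbf{e_{\frac{n+1}{2}}}.$$ *)

(* Defs.v *)
From HB Require Import structures.
From mathcomp Require Import all_boot all_order all_algebra.
From mathcomp Require Import reals.

Set Implicit Arguments.
Unset Strict Implicit.
Unset Printing Implicit Defensive.

Import Order.TTheory GRing.Theory Num.Theory.
Local Open Scope ring_scope.

Section Defs.
Variable R : realType.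

Definition ones (m : nat) : 'cV[R]_m := const_mx 1.

Definition Laplacian_like (m : nat) (A : 'M[R]_m) : Prop :=
  A *m ones m = 0 /\ (ones m)^T *m A = 0.

(* [iter i ord_pred j] is j - i modulo m, so row i is the i-fold cyclic right
   shift of c. *)
Definition Circ (m : nat) (c : 'rV[R]_m) : 'M[R]_m :=
  \matrix_(i, j) c 0 (iter i (@ord_pred m) j).

(* The subscripts of [basis_vec] and [c_vec] are 1-based, as on paper;
   ordinals are 0-based. *)
Definition basis_vec (m i : nat) : 'cV[R]_m := \col_(j < m) (j.+1 == i)%:R.

Definition c_vec (n k : nat) : 'cV[R]_(n.-1) :=
  basis_vec n.-1 k.+1 + basis_vec n.-1 (n - k)%N.

(* In z1 and z2 the divisions of naturals are exact for the n at which each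
   vector is used: n = 4 mod 6 for z1 and n = 1 mod 6 for z2. *)
Definition z1 (n : nat) : 'cV[R]_(n.-1) :=
  (2 * n%:R - n%:R ^+ 2) *: basis_vec n.-1 1
  + \sum_(1 <= k < ((n - 4) %/ 6).+1)
      (((3 * n%:R - 18 * k%:R + 8) / 2) *: c_vec n (3 * k - 2)%N
       - ((3 * n%:R - 18 * k%:R + 4) / 2) *: c_vec n (3 * k - 1)%N
       + c_vec n (3 * k)%N)
  + c_vec n (n %/ 2 - 1)%N.

Definition z2 (n : nat) : 'cV[R]_(n.-1) :=
  (2 * n%:R - n%:R ^+ 2) *: basis_vec n.-1 1
  + \sum_(1 <= k < ((n - 1) %/ 6).+1)
      (((3 * n%:R - 18 * k%:R + 8) / 2) *: c_vec n (3 * k - 2)%N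
       - ((3 * n%:R - 18 * k%:R + 4) / 2) *: c_vec n (3 * k - 1)%N)
  + \sum_(1 <= k < ((n - 7) %/ 6).+1) c_vec n (3 * k)%N
  + basis_vec n.-1 ((n + 1) %/ 2)%N.

Definition P_mx (n : nat) : 'M[R]_(n.-1) :=
  (3 * (n%:R - 1))^-1 *: Circ (if odd n then z2 n else z1 n)^T.

(* The size 1 + n.-1 is n as soon as n > 0. *)
Definition Lhat (n : nat) : 'M[R]_(1 + n.-1) :=
  ((n%:R - 1) / 3)%:M
  - 3^-1 *: block_mx 0 (ones n.-1)^T (ones n.-1) 0
  + block_mx 0 0 0 (P_mx n).

End Defs.

(* Main.v *)
(* Both the row sums and the column sums of a circulant matrix equal the sum s
   of its first row.  The first row and column of the matrix sum to zero
   trivially, and every other one sums to (n - 1)/3 - 1/3 + s/(3(n - 1)), so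
   all reduces to s = -(n - 1)(n - 2).  In s each [c_vec] contributes 2, so the
   k-th group of coefficients contributes 4 + 2 whatever k is. *)
Require Import Defs.
From mathcomp Require Import all_boot all_order all_algebra.
From mathcomp Require Import reals.
From mathcomp Require Import zify ring.

Import GRing.Theory Num.Theory.
Local Open Scope ring_scope.

(** Additive form of the index j - i modulo m read by [Circ] at row i and column j, which avoids
    truncated subtraction. *)
Lemma iter_ord_pred_mod (m i : nat) (j : 'I_m) :
  (iter i (@ord_pred m) j + i = j %[mod m])%N.
Proof.
have m_gt0 : (0 < m)%N by apply: leq_ltn_trans (ltn_ord j).
elim: i => [|i IHi]; first by rewrite addn0.
rewrite iterS /= modnDml.
(* [ord_pred] adds m before taking the predecessor, so with m > 0 nothing is truncated. *)
have -> : ((iter i (@ord_pred m) j + m).-1 + i.+1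
          = iter i (@ord_pred m) j + i + m)%N by lia.
by rewrite modnDr.
Qed.

(** If a and b lead to the same index, they are congruent modulo m, hence equal, both being below m.
    So each column of [Circ] is a permutation of its first row. *)
Lemma iter_ord_pred_inj (m : nat) (j : 'I_m) :
  injective (fun i : 'I_m => iter i (@ord_pred m) j).
Proof.
move=> a b /= eq_ab; apply/val_inj => /=.
have /eqP := iter_ord_pred_mod m a j.
rewrite eq_ab -(iter_ord_pred_mod m b j) eqn_modDl.
by rewrite !modn_small ?ltn_ord // => /eqP.
Qed.

Section EntrySum.
Variable R : realType.

Definition entry_sum (m : nat) (v : 'cV[R]_m) : R := \sum_i v i 0.

Lemma entry_sumD (m : nat) (u v : 'cV[R]_m) :
  entry_sum m (u + v) = entry_sum m u + entry_sum m v.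
Proof. by rewrite /entry_sum -big_split; apply: eq_bigr => i _; rewrite mxE. Qed.

Lemma entry_sumZ (m : nat) (a : R) (v : 'cV[R]_m) :
  entry_sum m (a *: v) = a * entry_sum m v.
Proof. by rewrite /entry_sum mulr_sumr; apply: eq_bigr => i _; rewrite mxE. Qed.

Lemma entry_sumB (m : nat) (u v : 'cV[R]_m) :
  entry_sum m (u - v) = entry_sum m u - entry_sum m v.
Proof. by rewrite -scaleN1r entry_sumD entry_sumZ mulN1r. Qed.

Lemma entry_sum_sum (m a b : nat) (F : nat -> 'cV[R]_m) :
  entry_sum m (\sum_(a <= k < b) F k) = \sum_(a <= k < b) entry_sum m (F k).
Proof.
rewrite /entry_sum exchange_big; apply: eq_bigr => i _.
by rewrite summxE.
Qed.

Lemma entry_sum_basis (m i : nat) :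
  (0 < i <= m)%N -> entry_sum m (basis_vec R m i) = 1.
Proof.
case: i => // i lt_im; rewrite /entry_sum (bigD1 (Ordinal lt_im)) //=.
rewrite mxE eqxx big1 ?addr0 // => j neq_ji.
by rewrite mxE eqSS -[_ == _]/(j == Ordinal lt_im) (negPf neq_ji).
Qed.

(** The bounds keep both subscripts k + 1 and n - k between 1 and n - 1; outside that range
    [basis_vec] is zero. *)
Lemma entry_sum_c_vec (n k : nat) :
  (0 < k)%N -> (k.+1 < n)%N -> entry_sum n.-1 (c_vec R n k) = 2.
Proof. by move=> k0 kn; rewrite entry_sumD !entry_sum_basis; [ring | lia..]. Qed.

(** With n = 6m + 4, the m groups give 6m and the last [c_vec] gives 2, so n - 2 is added to 2n -
    n^2. *)
Lemma entry_sum_z1 (n : nat) :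
  n = 4 %[mod 6] -> (4 <= n)%N ->
  entry_sum n.-1 (z1 R n) = - (n%:R - 1) * (n%:R - 2).
Proof.
move=> n_mod n_ge; have [m ->] : exists m, n = (6 * m + 4)%N.
  by exists ((n - 4) %/ 6)%N; lia.
have hm : ((6 * m + 4 - 4) %/ 6)%N = m by lia.
rewrite /z1 hm entry_sumD (entry_sumD _ (_ *: _)) entry_sumZ entry_sum_sum.
rewrite entry_sum_basis ?(entry_sum_c_vec _ ((6 * m + 4) %/ 2 - 1)%N); [|lia..].
under eq_big_nat => k k_bnd.
  rewrite entry_sumD entry_sumB !entry_sumZ !entry_sum_c_vec; [|lia..].
  rewrite (_ : _ + 2 = 6); last by field.
over.
rewrite sumr_const_nat subn1 /= -mulr_natr natrD natrM; ring.
Qed.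

(** With n = 6m + 7, there are m + 1 pairs worth 4, m vectors worth 2 and the middle basis vector
    worth 1: again n - 2 in all. *)
Lemma entry_sum_z2 (n : nat) :
  n = 1 %[mod 6] -> (7 <= n)%N ->
  entry_sum n.-1 (z2 R n) = - (n%:R - 1) * (n%:R - 2).
Proof.
move=> n_mod n_ge; have [m ->] : exists m, n = (6 * m + 7)%N.
  by exists ((n - 7) %/ 6)%N; lia.
have hm : ((6 * m + 7 - 1) %/ 6)%N = m.+1 by lia.
have hm' : ((6 * m + 7 - 7) %/ 6)%N = m by lia.
rewrite /z2 hm hm' !entry_sumD entry_sumZ !entry_sum_sum.
rewrite !entry_sum_basis; [|lia..].
under eq_big_nat => k k_bnd.
  rewrite entry_sumB !entry_sumZ !entry_sum_c_vec; [|lia..].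
  rewrite (_ : _ - _ = 4); last by field.
over.
under [X in _ + X + _]eq_big_nat => k k_bnd.
  rewrite entry_sum_c_vec; [|lia..].
over.
rewrite !sumr_const_nat !subn1 /= mulrS natrD natrM; ring.
Qed.

Lemma Circ_mul_ones (m : nat) (v : 'cV[R]_m) :
  Circ v^T *m ones R m = entry_sum m v *: ones R m.
Proof.
apply/matrixP => i j; rewrite !mxE mulr1 /entry_sum.
(* Along a row the number of shifts is fixed, so injectivity of [ord_pred] suffices. *)
have pred_inj : injective (iter i (@ord_pred m)).
  by elim: {i}(i : nat) => [|i IHi] x y //= /ord_pred_inj /IHi.
rewrite [RHS](reindex_inj pred_inj); apply: eq_bigr => k _.
by rewrite !mxE mulr1.
Qed.

Lemma ones_mul_Circ (m : nat) (v : 'cV[R]_m) :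
  (ones R m)^T *m Circ v^T = entry_sum m v *: (ones R m)^T.
Proof.
apply/matrixP => i j; rewrite !mxE mulr1 /entry_sum.
(* Down a column the start j is fixed and the number of shifts varies. *)
rewrite [RHS](reindex_inj (iter_ord_pred_inj m j)); apply: eq_bigr => k _.
by rewrite !mxE mul1r.
Qed.

Lemma ones_tr_mul_ones (m : nat) : (ones R m)^T *m ones R m = m%:R%:M.
Proof.
apply/matrixP => i j; rewrite !ord1 !mxE.
under eq_bigr do rewrite !mxE mulr1.
by rewrite sumr_const card_ord.
Qed.

End EntrySum.

Theorem theorem6p11 (R : realType) (n : nat) (hn : (10 <= n)%N)
    (hmod : n = 1 %[mod 3]) :
  Laplacian_like (Lhat R n).
Proof.
set z := if odd n then z2 R n else z1 R n.
have sum_z : entry_sum R n.-1 z = - (n%:R - 1) * (n%:R - 2).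
  (* Parity and n = 1 modulo 3 fix n modulo 6: 1 if odd, 4 if even. *)
  rewrite /z; case: ifPn => n_odd.
    by apply: entry_sum_z2; lia.
  by apply: entry_sum_z1; lia.
have n1 : n.-1%:R = n%:R - 1 :> R by rewrite -subn1 natrB //; lia.
have n1_neq0 : n%:R - 1 != 0 :> R by rewrite -n1 pnatr_eq0; lia.
(* [coef_ul] settles the first coordinate of both products, [coef_dr] the other n - 1. *)
have coef_ul : (n%:R - 1) / 3 + - 3^-1 * (n%:R - 1) = 0 :> R by ring.
have coef_dr : - 3^-1 + ((n%:R - 1) / 3 + (3 * (n%:R - 1))^-1
                 * (- (n%:R - 1) * (n%:R - 2))) = 0 :> R by field.
have onesE : ones R (1 + n.-1) = col_mx 1%:M (ones R n.-1).
  rewrite /ones -col_mx_const; congr col_mx.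
  by apply/matrixP => i j; rewrite !ord1 !mxE.
have LE : Lhat R n = block_mx ((n%:R - 1) / 3)%:M (- 3^-1 *: (ones R n.-1)^T)
   (- 3^-1 *: ones R n.-1) (((n%:R - 1) / 3)%:M + P_mx R n).
  rewrite /Lhat scalar_mx_block scale_block_mx opp_block_mx !add_block_mx.
  by rewrite !scaler0 !subr0 !add0r !addr0 -!scaleNr.
rewrite /Laplacian_like LE onesE; split.
  rewrite mul_block_col mulmxDl !mul_scalar_mx !mulmx1 -!scalemxAl.
  rewrite Circ_mul_ones -/z sum_z ones_tr_mul_ones n1 scalerA.
  rewrite -[RHS]col_mx0; congr col_mx.
    by rewrite !scale_scalar_mx mulr1 -raddfD coef_ul raddf0.
  by rewrite -!scalerDl coef_dr scale0r.
rewrite tr_col_mx tr_scalar_mx mul_row_block mulmxDr !mul1mx.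
rewrite !mul_mx_scalar -!scalemxAr ones_mul_Circ -/z sum_z.
rewrite ones_tr_mul_ones n1 scalerA -[RHS]row_mx0; congr row_mx.
  by rewrite scale_scalar_mx -raddfD coef_ul raddf0.
by rewrite -!scalerDl coef_dr scale0r.
Qed.
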